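(* Let $f\in C^1(\overline\Omega)$ satisfy $f(x)\ge 0$ on $\overline\Omega$ and $f\not\equiv 0$, and let $1<p<\frac{n+2}{n-2}$. Then there exists a positive number $\beta_f$ such that for every $\beta\in(0,\beta_f)$ the problem $$-\Delta u=u^p+f(x)\ \text{ in }\Omega,\qquad u>0\ \text{ in }\Omega,\qquad \frac{\partial u}{\partial\nu}+\beta u=0\ \text{ on }\partial\Omega$$ has no solution.
   Context: $n\ge 2$, $\Omega\subset\mathbb{R}^n$ is a bounded domain with smooth boundary $\partial\Omega$, and $\nu$ is the outward unit normal to $\partial\Omega$. The condition $1<p<\frac{n+2}{n-2}$ is read as $1<p<\infty$ when $n=2$. Solutions are understood in the classical sense. *)

(* Defs.v *)
From mathcomp Require Import all_boot all_order all_algebra.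
From mathcomp Require Import all_classical all_reals all_analysis.
Set Implicit Arguments.
Unset Strict Implicit.
Unset Printing Implicit Defensive.
Import Order.TTheory GRing.Theory Num.Theory.
Import numFieldNormedType.Exports.
Local Open Scope classical_set_scope.
Local Open Scope ring_scope.

(* Points of R^n are row vectors.  The norm that MathComp-Analysis puts on
   'rV[R]_n is the sup norm: it gives the usual topology and the usual bounded
   sets, but Euclidean lengths must go through [dot]. *)

Definition dot (R : realType) (n : nat) (x y : 'rV[R]_n) : R :=
  \sum_(i < n) x 0 i * y 0 i.

Definition enorm (R : realType) (n : nat) (x : 'rV[R]_n) : R :=
  Num.sqrt (dot x x).

Definition partial (R : realType) (n : nat) (i : 'I_n) (g : 'rV[R]_n -> R) :
  'rV[R]_n -> R := fun x => 'D_(delta_mx 0 i) g x.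

Definition gradient (R : realType) (n : nat) (g : 'rV[R]_n -> R)
  (x : 'rV[R]_n) : 'rV[R]_n := \row_i partial i g x.

Definition laplacian (R : realType) (n : nat) (g : 'rV[R]_n -> R)
  (x : 'rV[R]_n) : R := \sum_(i < n) partial i (partial i g) x.

(* g is C^k on the open set U.  Functions are total; values outside U are
   irrelevant because U is open. *)
Fixpoint Ck_on (R : realType) (n : nat) (U : set 'rV[R]_n) (k : nat)
    (g : 'rV[R]_n -> R) : Prop :=
  (forall x, U x -> {for x, continuous g}) /\
  (if k is k'.+1 then
     forall i : 'I_n, (forall x, U x -> derivable g x (delta_mx 0 i)) /\
                      Ck_on U k' (partial i g)
   else True).

Definition smooth_on (R : realType) (n : nat) (U : set 'rV[R]_n)
  (g : 'rV[R]_n -> R) : Prop := forall k, Ck_on U k g.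

(* The field G is the continuous extension to the closure of Omega of the
   gradient of g on Omega; it is unique on the closure. *)
Definition gradient_extension (R : realType) (n : nat) (Omega : set 'rV[R]_n)
    (g : 'rV[R]_n -> R) (G : 'rV[R]_n -> 'rV[R]_n) : Prop :=
  {within closure Omega, continuous G} /\
  (forall x, Omega x -> G x = gradient g x).

Definition C1_closure (R : realType) (n : nat) (Omega : set 'rV[R]_n)
    (g : 'rV[R]_n -> R) : Prop :=
  [/\ Ck_on Omega 1 g, {within closure Omega, continuous g} &
      exists G, gradient_extension Omega g G].

Definition bounded_domain (R : realType) (n : nat) (Omega : set 'rV[R]_n) :
  Prop := [/\ open Omega, connected Omega, Omega !=set0 & bounded_set Omega].

Definition boundary (R : realType) (n : nat) (Omega : set 'rV[R]_n) :
  set 'rV[R]_n := closure Omega `\` interior Omega.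

(* Near x, Omega is the sublevel set {rho < 0} of a smooth function without
   critical points; at a boundary point x this forces the boundary of Omega
   to be {rho = 0} in U, and gradient rho x points out of Omega. *)
Definition local_defining_function (R : realType) (n : nat)
    (Omega : set 'rV[R]_n) (x : 'rV[R]_n) (U : set 'rV[R]_n)
    (rho : 'rV[R]_n -> R) : Prop :=
  [/\ open U, U x, smooth_on U rho,
      (forall y, U y -> gradient rho y != 0) &
      (forall y, U y -> (Omega y <-> rho y < 0))].

Definition smooth_boundary (R : realType) (n : nat) (Omega : set 'rV[R]_n) :
  Prop :=
  forall x, boundary Omega x -> exists U rho,
    local_defining_function Omega x U rho.

Definition outward_unit_normal (R : realType) (n : nat)
    (Omega : set 'rV[R]_n) (nu : 'rV[R]_n -> 'rV[R]_n) : Prop :=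
  forall x, boundary Omega x -> exists U rho,
    local_defining_function Omega x U rho /\
    nu x = (enorm (gradient rho x))^-1 *: gradient rho x.

(* du/dnu = c at the boundary point x, where du/dnu is the scalar product of
   nu x with the boundary value of the gradient of u. *)
Definition is_normal_derivative (R : realType) (n : nat)
    (Omega : set 'rV[R]_n) (nu : 'rV[R]_n -> 'rV[R]_n) (u : 'rV[R]_n -> R)
    (x : 'rV[R]_n) (c : R) : Prop :=
  exists2 G, gradient_extension Omega u G & c = dot (G x) (nu x).

Definition robin_solution (R : realType) (n : nat) (Omega : set 'rV[R]_n)
    (nu : 'rV[R]_n -> 'rV[R]_n) (p : R) (f : 'rV[R]_n -> R) (beta : R)
    (u : 'rV[R]_n -> R) : Prop :=
  [/\ Ck_on Omega 2 u,
      C1_closure Omega u,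
      (forall x, Omega x -> - laplacian u x = u x `^ p + f x),
      (forall x, Omega x -> 0 < u x) &
      (forall x, boundary Omega x ->
         exists2 c, is_normal_derivative Omega nu u x c &
                    c + beta * u x = 0)].

(* Main.v *)
(** If [m] is the minimum of a solution [u], the boundary condition at a minimum
    point [z] reads [- du/dnu z = beta * m].  Since [u - m] is nonnegative and
    [- Delta (u - m) >= f], where [f] is bounded below on some ball, comparison
    with explicit barriers propagates a positive lower bound, independent of
    [u] and [beta], from that ball to every interior point (connectedness), and
    then gives a Hopf estimate [- du/dnu z >= kappa] with [kappa > 0] uniform on
    the boundary (compactness).  Hence [m >= kappa / beta] is large when [beta]
    is small.  But then [- Delta u >= u `^ p >= m `^ (p - 1) * u] on a fixed
    ball, which is impossible once [m `^ (p - 1)] exceeds a constant depending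
    only on the ball. *)

Require Import Defs.
From mathcomp Require Import all_boot all_order all_algebra.
From mathcomp Require Import all_classical all_reals all_analysis.
From mathcomp Require Import ring lra.
Set Implicit Arguments.
Unset Strict Implicit.
Unset Printing Implicit Defensive.
Import Order.TTheory GRing.Theory Num.Theory.
Import numFieldNormedType.Exports.
Local Open Scope classical_set_scope.
Local Open Scope ring_scope.

(** * Derivatives *)

(** Every constant must be fixed before the solution is known, so the lower bounds are stated for
    all pairs of a strict supersolution [u] and an arbitrary lower bound [m]. Strictness comes from
    the positive power term: [laplacian u < - f] in [Omega]. A barrier whose Laplacian dominates
    that of [u] is then excluded at an interior minimum of the difference by the second derivative
    test alone, one coordinate at a time. All barriers are polynomial expressions: a power of a
    squared radius minus a squared Euclidean distance in the interior, and a quadratic expression in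
    the defining function at the boundary, where it takes the role usually given to tangent interior
    balls. The interior barrier serves again at the end in the role of a first eigenfunction. Two
    mismatches shape the details. Balls are sup-norm balls while barriers are Euclidean, which costs
    factors of [n] in the radii. And at a boundary point [u] has only the continuous extension of
    its gradient, so the Hopf estimate goes through the mean value theorem on an inward segment. *)

Lemma is_derive_line (R : realType) (n : nat) (g : 'rV[R]_n -> R)
    (x v : 'rV[R]_n) (t d : R) :
  is_derive (x + t *: v) v g d ->
  is_derive t (1 : R) (fun s : R => g (x + s *: v)) d.
Proof.
suff E : (fun h : R => h^-1 *: (((fun s : R => g (x + s *: v)) \o shift t)
           (h *: (1 : R)) - g (x + t *: v))) =
         (fun h : R => h^-1 *: ((g \o shift (x + t *: v)) (h *: v)
                     - g (x + t *: v))).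
  move=> [dg gE]; split; first by rewrite /derivable E.
  by rewrite -gE /derive E.
apply/funext => h /=; congr (_ *: (g _ - _)).
by rewrite [h *: 1]mulr1 scalerDl addrCA.
Qed.

Lemma MVT_around0 (R : realType) (phi dphi : R -> R) (s : R) :
  (forall t, `|t| <= `|s| -> is_derive t (1 : R) phi (dphi t)) ->
  exists2 t, `|t| <= `|s| & phi s - phi 0 = dphi t * s.
Proof.
move=> D.
have [s0|s0] := leP 0 s.
  have [|t|t] := MVT_segment s0 (f := phi) (df := dphi).
  - move=> t /[!in_itv]/= /andP[t0 ts]; apply: D.
    by rewrite ger0_norm ?ltW// ger0_norm// ltW.
  - apply: derivable_within_continuous => {}t /[!in_itv]/= /andP[t0 ts].
    have [] // := D t.
    by rewrite ger0_norm// ger0_norm.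
  - move=> /[!in_itv]/= /andP[t0 ts] E; exists t; last by rewrite E subr0.
    by rewrite ger0_norm// ger0_norm.
have [||t|t] := @MVT_segment R phi dphi s 0; first exact: ltW.
- move=> t /[!in_itv]/= /andP[st t0]; apply: D.
  by rewrite (ltr0_norm t0) (ltr0_norm s0) lerN2 ltW.
- apply: derivable_within_continuous => {}t /[!in_itv]/= /andP[st t0].
  have [] // := D t.
  by rewrite (ler0_norm t0) (ltr0_norm s0) lerN2.
- move=> /[!in_itv]/= /andP[st t0] E; exists t.
    by rewrite (ler0_norm t0) (ltr0_norm s0) lerN2.
  by rewrite -opprB E sub0r mulrN opprK.
Qed.

Lemma nbhs_normrP (R : realType) (n : nat) (x : 'rV[R]_n)
    (P : 'rV[R]_n -> Prop) :
  (\forall y \near x, P y) <->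
  exists2 r : R, 0 < r & forall y, `|y - x| < r -> P y.
Proof.
split.
  move=> /nbhs_ballP[r /= r0 xP]; exists r => // y yx; apply: xP.
  by rewrite -ball_normE /= distrC.
move=> [r r0 xP]; apply/nbhs_ballP; exists r => //= y.
by rewrite -ball_normE /= distrC => /xP.
Qed.

Lemma norm_delta_mx_le1 (R : realType) (n : nat) (i : 'I_n) :
  `|delta_mx 0 i : 'rV[R]_n| <= 1.
Proof.
rewrite [leLHS]/Num.norm /= mx_normrE; apply/bigmax_leP; split => // -[a b] _ /=.
by rewrite mxE; case: (_ && _); rewrite ?normr1 ?normr0.
Qed.

(** [Ck_on] speaks of partial derivatives only, so a derivative in an arbitrary direction has to be
    assembled. The components of [v] are added one at a time; each increment is handled by the mean
    value theorem along one axis, and continuity of that partial derivative at [x] gives the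
    limit. *)
Lemma is_derive_C1 (R : realType) (n : nat) (U : set 'rV[R]_n)
    (g : 'rV[R]_n -> R) (x v : 'rV[R]_n) :
  open U -> Ck_on U 1 g -> U x -> is_derive x v g (dot (gradient g x) v).
Proof.
move=> oU [_ Cg] Ux.
suff S : (fun h : R => h^-1 *: (g (x + h *: v) - g x)) @ 0^' -->
         (dot (gradient g x) v : R).
  have E : (fun h : R => h^-1 *: ((g \o shift x) (h *: v) - g x)) =
      (fun h : R => h^-1 *: (g (x + h *: v) - g x)).
    by apply/funext => h /=; congr (_ *: (g _ - _)); exact: addrC.
  split; first by rewrite /derivable E; apply/cvg_ex; exists (dot (gradient g x) v).
  by rewrite /derive E; apply/cvg_lim.
suff S : forall r : seq 'I_n,
    (fun h : R => h^-1 *: (g (x + h *: (\sum_(i <- r) v 0 i *: delta_mx 0 i))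
                           - g x)) @ 0^' -->
       (\sum_(i <- r) partial i g x * v 0 i : R).
  have := S (index_enum 'I_n); rewrite -row_sum_delta.
  by rewrite (_ : dot _ _ = \sum_i partial i g x * v 0 i)//;
    apply: eq_bigr => i _; rewrite mxE.
elim=> [|i r IH].
  rewrite !big_nil; apply: cvg_near_cst; apply: nearW => h.
  by rewrite scaler0 addr0 subrr scaler0.
rewrite !big_cons.
set w := \sum_(j <- r) _ in IH *; set a := v 0 i.
suff : (fun h : R => h^-1 *: (g (x + h *: (a *: delta_mx 0 i + w))
                           - g (x + h *: w))) @ 0^' -->
       (partial i g x * a : R).
  move=> /cvgD/(_ IH); apply: cvg_trans; apply: near_eq_cvg.
  by apply: nearW => h /=; rewrite addrfctE -scalerDr addrA subrK.
apply/(@cvgrPdist_le R R) => e e0.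
have [dg [cg _]] := Cg i.
have : \forall y \near x, U y /\ `|partial i g y - partial i g x| <= e / (`|a| + 1).
  near=> y; split; first by near: y; exact: open_nbhs_nbhs.
  near: y; have := cg x Ux => /cvgrPdist_le/(_ (e / (`|a| + 1))).
  move=> /(_ _)/wrap[|]; first by rewrite divr_gt0// ltr_wpDl.
  by apply: filterS => y /=; rewrite distrC.
move=> /nbhs_normrP[d d0 dP].
pose C := `|w| + `|a| + 1.
have C0 : 0 < C by rewrite ltr_wpDl ?addr_ge0.
near=> h.
have hd : `|h| * (`|w| + `|a|) < d.
  apply: (@le_lt_trans _ _ (`|h| * C)).
    by rewrite ler_wpM2l// lerDl.
  rewrite -ltr_pdivlMr//.
  near: h; apply: cvg_within; apply/nbhs_ballP; exists (d / C) => /=.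
    by rewrite divr_gt0.
  by move=> h; rewrite /ball/= sub0r normrN.
have key t : `|t| <= `|h * a| ->
    `|x + h *: w + t *: delta_mx 0 i - x| < d.
  move=> tha; rewrite addrAC [x + _]addrC addrK.
  apply: le_lt_trans (ler_normD _ _) (le_lt_trans _ hd).
  rewrite mulrDr lerD// normrZ//.
  rewrite (le_trans (ler_pM _ _ tha (norm_delta_mx_le1 _ _)))// mulr1.
  by rewrite normrM.
have [|s sha] := @MVT_around0 R (fun t => g (x + h *: w + t *: delta_mx 0 i))
   (fun t => partial i g (x + h *: w + t *: delta_mx 0 i)) (h * a).
  move=> t /key/dP[Ut _]; apply: is_derive_line.
  by split=> //; exact: dg.
rewrite scale0r addr0 => E.
have -> : x + h *: (a *: delta_mx 0 i + w) =
    x + h *: w + (h * a) *: delta_mx 0 i.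
  by rewrite scalerDr scalerA addrA addrAC.
rewrite E.
have h0 : h != 0 by near: h; exact: nbhs_dnbhs_neq.
rewrite [_ *: _]mulrCA mulKf// -mulrBl normrM.
have [_] := dP _ (key _ sha); rewrite distrC => dle.
rewrite (le_trans (ler_wpM2r _ dle))//.
by rewrite mulrAC ler_pdivrMr ?ler_pM2l// ?lerDl// ltr_wpDl.
Unshelve. all: by end_near. Qed.

(** Derivability is required near [x], so that [partial i g] is a genuine derivative there before it
    is differentiated again. With the values as arguments, sums, products and powers become rules
    that compute them. *)
Definition jet2 (R : realType) (n : nat) (i : 'I_n) (g : 'rV[R]_n -> R)
    (x : 'rV[R]_n) (d1 d2 : R) : Prop :=
  [/\ \forall y \near x, derivable g y (delta_mx 0 i), partial i g x = d1 &
      is_derive x (delta_mx 0 i) (partial i g) d2].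

Section is_derive_pointwise.
Variables (R : realType) (V : normedModType R).
Implicit Types (f g : V -> R) (x v : V).

Lemma is_derive_addf f g x v (a b : R) : is_derive x v f a ->
  is_derive x v g b -> is_derive x v (fun y => f y + g y) (a + b).
Proof. by rewrite -[fun y => _]/(f + g) => df dg; exact: is_deriveD. Qed.

Lemma is_derive_mulf f g x v (a b : R) : is_derive x v f a ->
  is_derive x v g b -> is_derive x v (fun y => f y * g y) (f x * b + g x * a).
Proof. by rewrite -[fun y => _]/(f * g) => df dg; exact: is_deriveM. Qed.

Lemma is_derive_subf f g x v (a b : R) : is_derive x v f a ->
  is_derive x v g b -> is_derive x v (fun y => f y - g y) (a - b).
Proof. by rewrite -[fun y => _]/(f - g) => df dg; exact: is_deriveB. Qed.

End is_derive_pointwise.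

Section jet2.
Variables (R : realType) (n : nat) (i : 'I_n).
Implicit Types (g h : 'rV[R]_n -> R) (x : 'rV[R]_n).

Lemma jet2_near g h x d1 d2 : (\forall y \near x, derivable g y (delta_mx 0 i)) ->
  (\forall y \near x, partial i g y = h y) -> h x = d1 ->
  is_derive x (delta_mx 0 i) h d2 -> jet2 i g x d1 d2.
Proof.
move=> dg gh <- dh; split => //; first exact: nbhs_singleton gh.
by apply: near_eq_is_derive dh; near do apply/esym.
Unshelve. all: by end_near. Qed.

Lemma jet2_Ck (U : set 'rV[R]_n) g x : open U -> Ck_on U 2 g -> U x ->
  jet2 i g x (partial i g x) (partial i (partial i g) x).
Proof.
move=> oU [_ /(_ i)[dg [_ /(_ i)[ddg _]]]] Ux.
split => //; last by split => //; exact: ddg.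
by near=> y; apply: dg; near: y; exact: open_nbhs_nbhs.
Unshelve. all: by end_near. Qed.

Lemma jet2_cst (c : R) x : jet2 i (fun=> c) x 0 0.
Proof.
have E : partial i (fun=> c) = fun=> 0.
  by apply/funext => y; exact: derive_cst.
split; rewrite ?E//; first by near=> y; exact: derivable_cst.
exact: is_derive_cst.
Unshelve. all: by end_near.
Qed.

Lemma jet2D g h x a1 a2 b1 b2 : jet2 i g x a1 a2 -> jet2 i h x b1 b2 ->
  jet2 i (fun y => g y + h y) x (a1 + b1) (a2 + b2).
Proof.
move=> [dg ga ddg] [dh hb ddh].
have D : \forall y \near x, is_derive y (delta_mx 0 i) (fun y => g y + h y)
    (partial i g y + partial i h y).
  apply: filterS2 dg dh => y dgy dhy.
  by apply: is_derive_addf; exact: derivableP.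
apply: (jet2_near (h := fun y => partial i g y + partial i h y)).
- by apply: filterS D => y [].
- by apply: filterS D => y [].
- by rewrite ga hb.
Qed.

Lemma jet2M g h x a1 a2 b1 b2 : jet2 i g x a1 a2 -> jet2 i h x b1 b2 ->
  jet2 i (fun y => g y * h y) x (g x * b1 + h x * a1)
    (g x * b2 + 2 * (a1 * b1) + h x * a2).
Proof.
move=> [dg ga ddg] [dh hb ddh].
have D : \forall y \near x, is_derive y (delta_mx 0 i) (fun y => g y * h y)
    (g y * partial i h y + h y * partial i g y).
  apply: filterS2 dg dh => y dgy dhy.
  by apply: is_derive_mulf; exact: derivableP.
apply: (jet2_near (h := fun y => g y * partial i h y + h y * partial i g y)).
- by apply: filterS D => y [].
- by apply: filterS D => y [].
- by rewrite ga hb.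
have dgx : is_derive x (delta_mx 0 i) g a1.
  by rewrite -ga; apply: derivableP; exact: nbhs_singleton dg.
have dhx : is_derive x (delta_mx 0 i) h b1.
  by rewrite -hb; apply: derivableP; exact: nbhs_singleton dh.
have := is_derive_addf (is_derive_mulf dgx ddh) (is_derive_mulf dhx ddg).
by congr is_derive; rewrite ga hb; ring.
Qed.

Lemma jet2Z (c : R) g x a1 a2 : jet2 i g x a1 a2 ->
  jet2 i (fun y => c * g y) x (c * a1) (c * a2).
Proof.
move=> /(jet2M (jet2_cst c x)).
by rewrite mulr0 mul0r !mulr0 !addr0.
Qed.

Lemma jet2B g h x a1 a2 b1 b2 : jet2 i g x a1 a2 -> jet2 i h x b1 b2 ->
  jet2 i (fun y => g y - h y) x (a1 - b1) (a2 - b2).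
Proof.
move=> jg /(jet2Z (-1)) jh; rewrite -(mulN1r b1) -(mulN1r b2).
rewrite (_ : (fun y => _) = (fun y => g y + -1 * h y)); first exact: jet2D.
by apply/funext => y; rewrite mulN1r.
Qed.

Lemma jet2X g x a1 a2 (k : nat) : jet2 i g x a1 a2 ->
  jet2 i (fun y => g y ^+ k.+2) x (k.+2%:R * g x ^+ k.+1 * a1)
    (k.+2%:R * g x ^+ k * (k.+1%:R * a1 ^+ 2 + g x * a2)).
Proof.
move=> jg; elim: k => [|k IH].
  have := jet2M jg jg; rewrite (_ : (fun y => _) = fun y => g y ^+ 2).
    by congr jet2; rewrite ?expr1 ?expr0; ring.
  by apply/funext => y; rewrite expr2.
have := jet2M jg IH; rewrite (_ : (fun y => _) = fun y => g y ^+ k.+3).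
  by congr jet2; rewrite !exprS; ring.
by apply/funext => y; rewrite [RHS]exprS.
Qed.

(** If [d2 < 0], the first derivative, which vanishes at the minimum, is negative just to the right
    of [x] along the axis. By the mean value theorem [g] then drops below [g x]. Existence of the
    second derivative at the single point [x] suffices. *)
Lemma jet2_min_ge0 g x d1 d2 : jet2 i g x d1 d2 ->
  (\forall y \near x, g x <= g y) -> 0 <= d2.
Proof.
move=> [dg _ ddg] gmin; rewrite leNgt; apply/negP => d20.
have : \forall y \near x, derivable g y (delta_mx 0 i) /\ g x <= g y.
  by near=> y; split; near: y.
move=> /nbhs_normrP[r r0 rP].
pose e : 'rV[R]_n := delta_mx 0 i.
have inr t : `|t| < r -> `|x + t *: e - x| < r.
  move=> tr; rewrite addrAC subrr add0r normrZ (le_lt_trans _ tr)//.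
  by rewrite ler_piMr// norm_delta_mx_le1.
have line t : `|t| < r ->
    is_derive t (1 : R) (fun s => g (x + s *: e)) (partial i g (x + t *: e)).
  move=> /inr/rP[dgt _]; apply: is_derive_line.
  exact: derivableP.
have psi0 : partial i g x = 0.
  have [] := @derive1_at_min R (fun s => g (x + s *: e)) (- r) r 0.
  - by rewrite ge0_cp// ltW.
  - by move=> t; rewrite in_itv/= -ltr_norml => /line[].
  - by rewrite in_itv/= oppr_lt0 r0.
  - move=> t; rewrite in_itv/= -ltr_norml => /inr/rP[_].
    by rewrite scale0r addr0.
  move=> _ <-; have [] := line 0; first by rewrite normr0.
  by rewrite scale0r addr0.
have [] : is_derive (0 : R) (1 : R) (fun s => partial i g (x + s *: e)) d2.
  by apply: is_derive_line; rewrite scale0r addr0.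
move=> /cvg_ex[/= l dl] dE.
have {dE} E : l = d2 by rewrite -dE; apply/esym/cvg_lim.
rewrite {}E in dl.
have : \forall h \near 0^', h^-1 * partial i g (x + h *: e) < 0.
  move: dl => /cvgr_lt/(_ _ d20); apply: filterS => h /=.
  by rewrite scale0r !addr0 psi0 subr0 [_%:A]mulr1.
move=> /nbhs_ballP[s /= s0 sP].
have m0 : 0 < Num.min r s / 2 by rewrite divr_gt0// lt_min r0 s0.
have m2 : Num.min r s / 2 < Num.min r s by rewrite ltr_pdivrMr// ltr_pMr ?ltr1n// lt_min r0 s0.
set t := Num.min r s / 2 in m0 m2.
have [tr ts] : t < r /\ t < s by move: m2; rewrite lt_min => /andP[].
have [c||c] := @MVT R (fun s => g (x + s *: e)) (fun s => partial i g (x + s *: e)) 0 t m0.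
- rewrite in_itv/= => /andP[c0 ct]; apply: line.
  by rewrite gtr0_norm// (lt_trans ct).
- apply: derivable_within_continuous => c; rewrite in_itv/= => /andP[c0 ct].
  by have [] // := line c; rewrite ger0_norm// (le_lt_trans ct).
rewrite in_itv/= => /andP[c0 ct].
have [|_ gt] := rP (x + t *: e); first by apply: inr; rewrite gtr0_norm.
rewrite scale0r addr0 subr0 => E.
have : 0 <= partial i g (x + c *: e).
  by rewrite -(pmulr_lge0 _ m0) -E subr_ge0.
rewrite leNgt => /negP; apply.
have := sP c; rewrite /ball/= sub0r normrN gtr0_norm// (lt_trans ct)//.
move=> /(_ isT); rewrite gt_eqF// => /(_ isT).
by rewrite pmulr_rlt0 ?invr_gt0.
Unshelve. all: by end_near. Qed.

End jet2.

(** * Comparison with radial barriers *)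

Section dot.
Variables (R : realType) (n : nat).
Implicit Types (x y v : 'rV[R]_n) (a : R).

Lemma dotC x y : dot x y = dot y x.
Proof. by apply: eq_bigr => i _; rewrite mulrC. Qed.

Lemma dotDl x y v : dot (x + y) v = dot x v + dot y v.
Proof. by rewrite -big_split; apply: eq_bigr => i _; rewrite mxE mulrDl. Qed.

Lemma dotDr x y v : dot v (x + y) = dot v x + dot v y.
Proof. by rewrite dotC dotDl !(dotC _ v). Qed.

Lemma dotZl a x v : dot (a *: x) v = a * dot x v.
Proof. by rewrite mulr_sumr; apply: eq_bigr => i _; rewrite mxE mulrA. Qed.

Lemma dotZr a x v : dot v (a *: x) = a * dot v x.
Proof. by rewrite dotC dotZl dotC. Qed.

Lemma dotNl x v : dot (- x) v = - dot x v.
Proof. by rewrite -scaleN1r dotZl mulN1r. Qed.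

Lemma dotNr x v : dot v (- x) = - dot v x.
Proof. by rewrite dotC dotNl dotC. Qed.

Lemma dot0l v : dot 0 v = 0.
Proof. by rewrite -(scale0r 0) dotZl mul0r. Qed.

Lemma dot_ge0 x : 0 <= dot x x.
Proof. by apply: sumr_ge0 => i _; rewrite -expr2 sqr_ge0. Qed.

Lemma coord_le_norm x (i : 'I_n) : `|x 0 i| <= `|x|.
Proof.
rewrite [leRHS]/Num.norm /= mx_normrE.
by apply: (le_bigmax_cond 0 (fun j : 'I_1 * 'I_n => `|x j.1 j.2|) (j := (0, i))).
Qed.

Lemma norm_sqr_le_dot x : `|x| ^+ 2 <= dot x x.
Proof.
have [->|x0] := eqVneq x 0; first by rewrite normr0 expr0n dot_ge0.
have [|[a i] /= E] := @mx_norm_neq0 _ _ _ x; first by rewrite -normr_eq0 in x0.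
have -> : `|x| = `|x 0 i|.
  by rewrite [LHS]/Num.norm /= E (ord1 a).
rewrite real_normK ?num_real// /dot (bigD1 i)//= -expr2 lerDl.
by apply: sumr_ge0 => j _; rewrite -expr2 sqr_ge0.
Qed.

Lemma dot_le_norm_sqr x : dot x x <= n%:R * `|x| ^+ 2.
Proof.
have -> : n%:R * `|x| ^+ 2 = \sum_(i < n) `|x| ^+ 2.
  by rewrite sumr_const card_ord mulr_natl.
apply: ler_sum => i _.
rewrite -expr2 -real_normK ?num_real// lerXn2r ?nnegrE//.
exact: coord_le_norm.
Qed.

Lemma dot_eq0 x : (dot x x == 0) = (x == 0).
Proof.
apply/idP/eqP => [/eqP d0|->]; last by rewrite dot0l.
have := norm_sqr_le_dot x; rewrite d0 => h.
have /eqP : `|x| ^+ 2 = 0 by apply/eqP; rewrite eq_le h sqr_ge0.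
by rewrite expf_eq0/= normr_eq0 => /eqP.
Qed.

Lemma dot_gt0 x : x != 0 -> 0 < dot x x.
Proof. by rewrite lt_def dot_eq0 dot_ge0 andbT. Qed.

Lemma is_derive_sqdist (z x v : 'rV[R]_n) :
  is_derive x v (fun y => dot (y - z) (y - z)) (2 * dot (x - z) v).
Proof.
suff S : (fun h : R => h^-1 *: (((fun y => dot (y - z) (y - z)) \o shift x)
    (h *: v) - dot (x - z) (x - z))) @ 0^' --> (2 * dot (x - z) v : R).
  split; first by apply/cvg_ex; exists (2 * dot (x - z) v).
  exact: cvg_lim.
have : (fun h : R => 2 * dot (x - z) v + h * dot v v) @ 0^' -->
    (2 * dot (x - z) v + 0 * dot v v : R).
  apply: cvgD; first exact: cvg_cst.
  by apply: cvgMl; apply: cvg_within.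
rewrite mul0r addr0; apply: cvg_trans; apply: near_eq_cvg.
near=> h; have h0 : h != 0 by near: h; exact: nbhs_dnbhs_neq.
rewrite /= -addrA !(dotDl (h *: v)) !(dotDr (h *: v)) !dotZl !dotZr.
rewrite (dotC v (x - z)) /GRing.scale/=; field.
Unshelve. all: by end_near. Qed.

Lemma cvg_dot (T : Type) (F : set_system T) (f g : T -> 'rV[R]_n) x y :
  Filter F -> f @ F --> x -> g @ F --> y ->
  (fun t => dot (f t) (g t)) @ F --> (dot x y : R).
Proof.
move=> FF fx gy; apply: cvg_big => [|i _]; first exact: add_continuous.
apply: cvgM.
- exact: (cvg_comp _ _ fx (@coord_continuous _ _ _ 0 i x)).
- exact: (cvg_comp _ _ gy (@coord_continuous _ _ _ 0 i y)).
Qed.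

Lemma continuous_sqdist (z : 'rV[R]_n) :
  continuous (fun y => dot (y - z) (y - z) : R).
Proof.
move=> x; have xz : {for x, continuous (fun y : 'rV[R]_n => y - z)}.
  apply: (@continuousB _ _ _ id (cst z)); last exact: cst_continuous.
  by move=> A.
exact: (@cvg_dot _ _ _ _ _ _ (nbhs_filter _) xz xz).
Qed.

End dot.

(** A relation, so that the second derivatives of a barrier can be read off the [jet2] rules
    together with the evidence that they exist. *)
Definition has_laplacian (R : realType) (n : nat) (g : 'rV[R]_n -> R)
    (x : 'rV[R]_n) (L : R) : Prop :=
  exists d1 d2 : 'I_n -> R,
    (forall i, jet2 i g x (d1 i) (d2 i)) /\ L = \sum_i d2 i.

Section comparison.
Variables (R : realType) (n : nat).
Implicit Types (g u b : 'rV[R]_n -> R) (x y z : 'rV[R]_n).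

Lemma has_laplacian_Ck (U : set 'rV[R]_n) g x : open U -> Ck_on U 2 g -> U x ->
  has_laplacian g x (laplacian g x).
Proof.
move=> oU Cg Ux; exists (fun i => partial i g x).
by exists (fun i => partial i (partial i g) x); split=> // i; exact: jet2_Ck Ux.
Qed.

Lemma has_laplacianZ (c : R) g x L : has_laplacian g x L ->
  has_laplacian (fun y => c * g y) x (c * L).
Proof.
move=> [d1 [d2 [jg ->]]]; exists (fun i => c * d1 i), (fun i => c * d2 i).
by split => [i|]; [exact: jet2Z | rewrite mulr_sumr].
Qed.

Lemma laplacian_le_at_min u b x (Lu Lb : R) :
  has_laplacian u x Lu -> has_laplacian b x Lb ->
  (\forall y \near x, u x - b x <= u y - b y) -> Lb <= Lu.
Proof.
move=> [u1 [u2 [ju ->]]] [b1 [b2 [jb ->]]] mn.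
apply: ler_sum => i _; rewrite -subr_ge0.
exact: jet2_min_ge0 (jet2B (ju i) (jb i)) mn.
Qed.

(** Only a minimum point of [u - b] on [K] matters: there the first alternative gives the bound
    everywhere, and the second contradicts the second derivative test. The disjunction lets any
    region where the bound is already known, such as an inner ball, act as part of the boundary. *)
Lemma comparison_principle (K : set 'rV[R]_n) u b (m : R) :
  compact K -> {within K, continuous u} -> {within K, continuous b} ->
  (forall x, K x -> m + b x <= u x \/
     [/\ \forall y \near x, K y & exists Lu Lb,
       [/\ has_laplacian u x Lu, has_laplacian b x Lb & Lu < Lb]]) ->
  forall x, K x -> m + b x <= u x.
Proof.
move=> cK cu cb H x Kx.
have cub : {within K, continuous (u - b)} by move=> t; exact: cvgB (cu t) (cb t).
have [|c cK' cmin] := compact_EVT_min _ cK cub; first by exists x.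
have Kc : K c by rewrite inE in cK'.
suff : m + b c <= u c.
  have := cmin x (mem_set Kx); rewrite !fctE; lra.
have [//|[Kn [Lu [Lb [hu hb]]]]] := H c Kc.
rewrite ltNge => /negP; case; apply: laplacian_le_at_min hu hb _.
by apply: filterS Kn => y Ky; exact: (cmin y (mem_set Ky)).
Qed.

(** Here [r] is the square of the radius. The exponent is at least 2, so that the Laplacian still
    carries the factor with exponent [k]. *)
Definition barrier (z : 'rV[R]_n) (r : R) (k : nat) (y : 'rV[R]_n) : R :=
  (r - dot (y - z) (y - z)) ^+ k.+2.

Lemma jet2_sqdist (i : 'I_n) z x :
  jet2 i (fun y => dot (y - z) (y - z)) x (2 * (x - z) 0 i) 2.
Proof.
have dotd v : dot v (delta_mx 0 i) = v 0 i.
  rewrite /dot (bigD1 i)//= mxE !eqxx mulr1 big1 ?addr0// => j ji.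
  by rewrite mxE (negbTE ji) andbF mulr0.
have D y : is_derive y (delta_mx 0 i) (fun y => dot (y - z) (y - z))
    (2 * (y - z) 0 i).
  by rewrite -dotd; exact: is_derive_sqdist.
apply: (jet2_near (h := fun y => 2 * (y - z) 0 i)) => //.
- by near=> y; have [] := D y.
- by near=> y; have [] := D y.
suff D1 : is_derive x (delta_mx 0 i : 'rV[R]_n) (fun y => (y - z) 0 i : R) 1.
  have := is_derive_mulf (is_derive_cst (2 : R) x (delta_mx 0 i)) D1.
  by congr is_derive; rewrite /cst mulr1 mulr0 addr0.
have E : (fun h : R => h^-1 *: (((fun y => (y - z) 0 i : R) \o shift x)
    (h *: delta_mx 0 i) - (x - z) 0 i)) @ 0^' --> (1 : R).
  apply: cvg_near_cst; near=> h.
  have h0 : h != 0 by near: h; exact: nbhs_dnbhs_neq.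
  by rewrite /= !mxE !eqxx /= /GRing.scale/=; field.
by split; [apply/cvg_ex; exists 1 | exact: cvg_lim].
Unshelve. all: by end_near. Qed.

(** With [q = r - s], the squared gradient of [q] is [4 * s] and its Laplacian is [- 2 * n]. Away
    from the centre, a large [k] makes the last factor positive. *)
Lemma has_laplacian_barrier z (r : R) (k : nat) x :
  let s := dot (x - z) (x - z) in
  has_laplacian (barrier z r k) x
    (k.+2%:R * (r - s) ^+ k * (4 * k.+1%:R * s - 2 * n%:R * (r - s))).
Proof.
move=> s; pose q1 i := 0 - 2 * (x - z) 0 i; pose q2 : R := 0 - 2.
have jq i : jet2 i (barrier z r k) x (k.+2%:R * (r - s) ^+ k.+1 * q1 i)
   (k.+2%:R * (r - s) ^+ k * (k.+1%:R * q1 i ^+ 2 + (r - s) * q2)).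
  by apply: (@jet2X _ _ i (fun y => r - dot (y - z) (y - z)));
    apply: jet2B; [exact: jet2_cst | exact: jet2_sqdist].
exists (fun i => k.+2%:R * (r - s) ^+ k.+1 * q1 i).
exists (fun i => k.+2%:R * (r - s) ^+ k * (k.+1%:R * q1 i ^+ 2 + (r - s) * q2)).
split => //; rewrite -mulr_sumr; congr (_ * _).
rewrite big_split/= -mulr_sumr sumr_const card_ord.
have -> : \sum_i q1 i ^+ 2 = 4 * s.
  by rewrite /s/dot mulr_sumr; apply: eq_bigr => i _; rewrite /q1; ring.
rewrite -[_ *+ n]mulr_natl /q2; ring.
Qed.

Lemma continuous_barrier z (r : R) (k : nat) : continuous (barrier z r k).
Proof.
move=> x; apply: (@continuous_comp _ _ _ (fun y => r - dot (y - z) (y - z))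
  (fun t => t ^+ k.+2)); last exact: exprn_continuous.
apply: (@continuousB _ _ _ (cst r)); first exact: cst_continuous.
exact: continuous_sqdist.
Qed.

End comparison.

(** * Interior lower bounds *)

Lemma compact_closed_ball (R : realType) (n : nat) (z : 'rV[R]_n) (r : R) :
  compact [set y : 'rV[R]_n | `|y - z| <= r].
Proof.
apply: bounded_closed_compact.
  exists (r + `|z|); split; first exact: num_real.
  move=> M rM y /= yz; apply: le_trans (ltW rM).
  by rewrite -[y](subrK z) (le_trans (ler_normD _ _))// lerD2r.
rewrite (_ : mkset _ = closed_ball_ Num.norm z r); first exact: closed_closed_ball_.
by apply/seteqP; split => y /=; rewrite distrC.
Qed.

Section interior_lift.
Variables (R : realType) (n : nat) (Omega : set 'rV[R]_n) (f : 'rV[R]_n -> R).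
Hypotheses (n2 : (2 <= n)%N) (oO : open Omega).
Hypothesis f_ge0 : forall x, Omega x -> 0 <= f x.
Implicit Types (u : 'rV[R]_n -> R) (x y z : 'rV[R]_n) (m c : R).

Definition supersolution u m : Prop :=
  [/\ Ck_on Omega 2 u, forall x, Omega x -> laplacian u x < - f x &
      forall x, Omega x -> m <= u x].

Definition lifted c x : Prop := forall u m, supersolution u m -> m + c <= u x.

(** One constant on a whole ball: propagation to other points starts from an inner ball on which the
    gain is already known. *)
Definition locally_lifted x : Prop := exists r c,
  [/\ 0 < r, 0 < c & forall y, `|y - x| < r -> lifted c y].

Lemma le_lifted c c' x : c' <= c -> lifted c x -> lifted c' x.
Proof. by move=> cc' H u m /H; apply: le_trans; rewrite lerD2l. Qed.

(* For odd [k] the barrier is nonpositive outside the Euclidean ball of radius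
   [rho], hence on the boundary of the sup-norm ball, which contains it. *)
Lemma barrier_comparison z (rho : R) (k : nat) (eps : R) u m :
  odd k -> 0 <= eps -> (forall x, `|x - z| <= rho -> Omega x) ->
  Ck_on Omega 2 u -> (forall x, Omega x -> m <= u x) ->
  (forall x, `|x - z| < rho ->
    let s := dot (x - z) (x - z) in let q := rho ^+ 2 - s in 0 < q ->
    m + eps * barrier z (rho ^+ 2) k x <= u x \/
    laplacian u x < eps * (k.+2%:R * q ^+ k * (4 * k.+1%:R * s - 2 * n%:R * q))) ->
  forall x, `|x - z| <= rho -> m + eps * barrier z (rho ^+ 2) k x <= u x.
Proof.
move=> ok eps0 BO Cu um H.
apply: (@comparison_principle _ _ _ u (fun x => eps * barrier z (rho ^+ 2) k x)).
- exact: compact_closed_ball.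
- apply: continuous_in_subspaceT => x; rewrite inE => /= /BO Ox.
  by case: Cu => + _; exact.
- apply: continuous_subspaceT => x.
  apply: (@continuousM _ _ (cst eps) (barrier z (rho ^+ 2) k)).
    exact: cst_continuous.
  exact: continuous_barrier.
move=> x /= xz; set q := rho ^+ 2 - dot (x - z) (x - z).
have [q0|q0] := leP q 0.
  left; apply: le_trans (um _ (BO _ xz)); rewrite gerDl.
  by rewrite mulr_ge0_le0// /barrier -/q exprn_odd_le0//= negbK.
have xz' : `|x - z| < rho.
  rewrite lt_neqAle xz andbT; apply/negP => /eqP E.
  by have := norm_sqr_le_dot (x - z); rewrite E -subr_le0 -/q leNgt q0.
have [?|L] := H x xz' q0; [by left|right; split].
  apply/nbhs_normrP; exists (rho - `|x - z|); first by rewrite subr_gt0.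
  move=> y yx; rewrite -(subrK x y) -addrA (le_trans (ler_normD _ _))//.
  by rewrite -lerBrDr ltW.
exists (laplacian u x), (eps * (k.+2%:R * q ^+ k *
  (4 * k.+1%:R * dot (x - z) (x - z) - 2 * n%:R * q))); split => //.
- by apply: has_laplacian_Ck Cu _ => //; exact: BO.
- by apply: has_laplacianZ; exact: has_laplacian_barrier.
Qed.

(** Squared Euclidean length is at most [n] times the squared sup norm, so the radius [rho / n]
    keeps the squared distance below [rho ^+ 2 / n], hence below half of [rho ^+ 2] because
    [2 <= n]. *)
Lemma barrier_ge z (rho : R) (k : nat) x : `|x - z| <= rho / n%:R ->
  (rho ^+ 2 / 2) ^+ k.+2 <= barrier z (rho ^+ 2) k x.
Proof.
move=> xz; have n0 : 2 <= n%:R :> R by rewrite ler_nat.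
have sq : dot (x - z) (x - z) <= rho ^+ 2 / 2.
  apply: le_trans (dot_le_norm_sqr _) _.
  have : `|x - z| ^+ 2 <= (rho / n%:R) ^+ 2.
    by rewrite lerXn2r ?nnegrE// (le_trans _ xz).
  rewrite -(ler_pM2l (_ : 0 < n%:R)) ?(lt_le_trans _ n0)// => /le_trans; apply.
  have -> : n%:R * (rho / n%:R) ^+ 2 = rho ^+ 2 / n%:R.
    by field; rewrite pnatr_eq0 -lt0n (leq_trans _ n2).
  have n00 : 0 < n%:R :> R by rewrite (lt_le_trans _ n0).
  by rewrite ler_wpM2l ?sqr_ge0// lef_pV2// posrE ltr0n.
have r2 : 0 <= rho ^+ 2 / 2 by rewrite divr_ge0// sqr_ge0.
by rewrite /barrier lerXn2r ?nnegrE//; lra.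
Qed.

Lemma lifted_source z (r d : R) : 0 < r -> 0 < d ->
  (forall x, `|x - z| <= r -> Omega x /\ d <= f x) -> locally_lifted z.
Proof.
move=> r0 d0 zr; have n0 : 2 <= n%:R :> R by rewrite ler_nat.
have r20 : 0 < r ^+ 2 by rewrite exprn_gt0.
(* For [k = 1] the Laplacian of the barrier is [3 * q * (8 * s - 2 * n * q)], at least
   [- 6 * n * q ^+ 2], and [q] is at most [r ^+ 2]; scaled by [eps] it stays above [- d]. *)
pose eps := d / (6 * n%:R * (r ^+ 2) ^+ 2).
have D0 : 0 < 6 * n%:R * (r ^+ 2) ^+ 2.
  by rewrite !mulr_gt0 ?exprn_gt0// (lt_le_trans _ n0).
have eps0 : 0 < eps by rewrite divr_gt0.
exists (r / n%:R), (eps * (r ^+ 2 / 2) ^+ 3); split.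
- by rewrite divr_gt0// (lt_le_trans _ n0).
- by rewrite mulr_gt0// exprn_gt0// divr_gt0.
move=> y yz u m [Cu Lu um].
have yr : `|y - z| <= r.
  rewrite (le_trans (ltW yz))// ler_pdivrMr ?(lt_le_trans _ n0)//.
  by rewrite ler_peMr ?(ltW r0)// (le_trans _ n0)// ler1n.
apply: (@le_trans _ _ (m + eps * barrier z (r ^+ 2) 1 y)).
  by rewrite lerD2l ler_pM2l// barrier_ge// ltW.
apply: barrier_comparison yr => //; [exact: ltW| by move=> x /zr[]|].
move=> x /ltW/zr[Ox dx] s q q0; right.
have s0 : 0 <= s by exact: dot_ge0.
apply: lt_le_trans (Lu _ Ox) _; apply: (@le_trans _ _ (- d)).
  by rewrite lerN2.
rewrite -[d](divfK (lt0r_neq0 D0)) -/eps -mulrN ler_pM2l// expr1.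
have qr : q ^+ 2 <= (r ^+ 2) ^+ 2.
  by rewrite lerXn2r ?nnegrE ?sqr_ge0 ?(ltW q0)// gerBl.
have : n%:R * q ^+ 2 <= n%:R * (r ^+ 2) ^+ 2 by rewrite ler_wpM2l// (le_trans _ n0).
have : 0 <= q * s by rewrite mulr_ge0// ltW.
nra.
Qed.

(** On the inner ball where the gain [c] is known, the scaled barrier is at most [c]; outside it,
    where the barrier is positive, a large exponent makes it subharmonic. How far the gain travels
    depends on [r] alone, not on the size of the inner ball. *)
Lemma lifted_propagate x y (r : R) : 0 < r -> `|y - x| < r / (2 * n%:R) ->
  (forall z, `|z - x| <= r -> Omega z) -> locally_lifted x -> locally_lifted y.
Proof.
move=> r0 yx BO [d [c [d0 c0 xc]]]; have n0 : 2 <= n%:R :> R by rewrite ler_nat.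
have n00 : 0 < n%:R :> R by rewrite (lt_le_trans _ n0).
have r20 : 0 < r ^+ 2 by rewrite exprn_gt0.
(* Off the inner ball [s >= d ^+ 2], and always [q <= r ^+ 2], so this inequality is the sign
   condition on the Laplacian of the barrier. *)
have [k ok kd] : exists2 k : nat, odd k & 2 * n%:R * r ^+ 2 < 4 * k.+1%:R * d ^+ 2.
  pose N := Num.bound (2 * n%:R * r ^+ 2 / (4 * d ^+ 2)).
  exists N.*2.+1; first by rewrite /= odd_double.
  have := archi_boundP (_ : 0 <= 2 * n%:R * r ^+ 2 / (4 * d ^+ 2)).
  rewrite -/N => /(_ _)/wrap[].
    by apply: divr_ge0; rewrite pmulr_rge0 ?sqr_ge0// mulr_gt0.
  rewrite ltr_pdivrMr ?mulr_gt0 ?exprn_gt0// => /lt_le_trans; apply.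
  rewrite mulrCA mulrA ler_wpM2r ?sqr_ge0// ler_wpM2l// ler_nat.
  by rewrite -addnn -addnS -addnS leq_addr.
(* Where [q] is positive the barrier is at most its value at the centre; this scaling turns that
   value into [c]. *)
pose eps := c / (r ^+ 2) ^+ k.+2.
have D0 : 0 < (r ^+ 2) ^+ k.+2 by rewrite exprn_gt0.
have eps0 : 0 < eps by rewrite divr_gt0.
exists (r / (2 * n%:R)), (eps * (r ^+ 2 / 2) ^+ k.+2); split.
- by rewrite divr_gt0// mulr_gt0.
- by rewrite mulr_gt0// exprn_gt0// divr_gt0.
move=> z zy u m S; have [Cu Lu um] := S.
have zx : `|z - x| <= r / n%:R.
  rewrite -(subrK y z) -addrA (le_trans (ler_normD _ _))//.
  rewrite (le_trans (ltW (ltrD zy yx)))//.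
  by rewrite le_eqVlt; apply/orP; left; apply/eqP; field; rewrite lt0r_neq0.
have zr : `|z - x| <= r.
  rewrite (le_trans zx)// ler_pdivrMr//.
  by rewrite ler_peMr ?(ltW r0)// (le_trans _ n0)// ler1n.
apply: (@le_trans _ _ (m + eps * barrier x (r ^+ 2) k z)).
  by rewrite lerD2l ler_pM2l// barrier_ge.
apply: barrier_comparison zr => //; first exact: ltW.
move=> w wx s q q0; have [wd|wd] := ltP `|w - x| d.
  left; apply: le_trans (xc _ wd _ _ S); rewrite lerD2l.
  rewrite -[c](divfK (lt0r_neq0 D0)) -/eps ler_pM2l//.
  rewrite lerXn2r ?nnegrE ?(ltW r20) ?(ltW q0)// gerBl; exact: dot_ge0.
have Ow : Omega w by apply: BO; exact: ltW.
right; apply: (@lt_trans _ _ 0).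
  by rewrite (lt_le_trans (Lu _ Ow))// oppr_le0 f_ge0.
rewrite mulr_gt0// mulr_gt0 ?mulr_gt0 ?exprn_gt0// subr_gt0.
have sd : d ^+ 2 <= s.
  apply: le_trans (norm_sqr_le_dot _).
  by rewrite lerXn2r ?nnegrE// ltW.
apply: (@lt_le_trans _ _ (4 * k.+1%:R * d ^+ 2)).
  apply: le_lt_trans kd; rewrite ler_pM2l ?mulr_gt0// gerBl; exact: dot_ge0.
by rewrite ler_pM2l// mulr_gt0.
Qed.

(** The lifted points form a relatively open and closed part of [Omega]. For closedness, a lifted
    point close enough to a limit point [y] reaches [y] in one propagation step, since the step
    length is controlled by the room around [y] only. *)
Lemma locally_lifted_connected z : connected Omega -> Omega z ->
  locally_lifted z -> forall x, Omega x -> locally_lifted x.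
Proof.
move=> cO Oz lz x Ox; have n0 : 2 <= n%:R :> R by rewrite ler_nat.
have n00 : 0 < n%:R :> R by rewrite (lt_le_trans _ n0).
suff E : Omega `&` locally_lifted = Omega.
  by have [] : (Omega `&` locally_lifted) x by rewrite E.
apply: cO.
- by exists z.
- exists locally_lifted => //; rewrite openE => y [r [c [r0 c0 yc]]].
  apply/nbhs_normrP; exists (r / 2); first by rewrite divr_gt0.
  move=> w wy; exists (r / 2), c; split => //; first by rewrite divr_gt0.
  move=> v vw; apply: yc; rewrite -(subrK w v) -addrA.
  by rewrite (le_lt_trans (ler_normD _ _))// [r]splitr ltrD.
exists (closure (Omega `&` locally_lifted)); first exact: closed_closure.
apply/seteqP; split => [y [Oy ly]|y [Oy cy]].
  by split => //; apply: subset_closure.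
split => //; have : \forall w \near y, Omega w by exact: open_nbhs_nbhs.
move=> /nbhs_normrP[r r0 rO].
pose e := r / 2 / (2 * n%:R).
have e0 : 0 < e by rewrite !divr_gt0// mulr_gt0.
have er : e <= r / 2.
  rewrite ler_pdivrMr ?mulr_gt0// ler_peMr ?divr_ge0 ?(ltW r0)//; lra.
have : nbhs y [set w | `|w - y| < e] by apply/nbhs_normrP; exists e.
move=> /cy[w [[Ow lw] /= wy]]; have r20 : 0 < r / 2 by rewrite divr_gt0.
apply: (lifted_propagate r20 _ _ lw); first by rewrite distrC.
move=> v vw; apply: rO; rewrite -(subrK w v) -addrA.
rewrite (le_lt_trans (ler_normD _ _))// [r]splitr ler_ltD//.
exact: lt_le_trans wy _.
Qed.

End interior_lift.

(** * The boundary estimate *)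

Section defining_functions.
Variables (R : realType) (n : nat) (Omega : set 'rV[R]_n).
Hypothesis oO : open Omega.
Implicit Types (g rho : 'rV[R]_n -> R) (x v : 'rV[R]_n).

Lemma cvg_quotient_right g x v d : is_derive x v g d ->
  (fun t : R => t^-1 * (g (x + t *: v) - g x)) @ 0^'+ --> (d : R).
Proof.
move=> [/cvg_ex[/= l gl] gd].
have {gd} E : l = d by rewrite -gd; apply/esym/cvg_lim.
rewrite {}E in gl; apply: cvg_dnbhs_at_right; apply: cvg_trans gl.
by apply: near_eq_cvg; apply: nearW => t /=; rewrite (addrC x).
Qed.

Lemma near_line_right (P : 'rV[R]_n -> Prop) x v :
  (\forall y \near x, P y) -> \forall t \near (0 : R)^'+, P (x + t *: v).
Proof.
move=> /nbhs_normrP[r r0 xP].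
have v0 : 0 < `|v| + 1 by rewrite ltr_wpDl.
near=> t; apply: xP; rewrite addrAC subrr add0r normrZ.
have t0 : 0 < t by near: t; exact: nbhs_right_gt.
rewrite gtr0_norm//; apply: (@le_lt_trans _ _ (t * (`|v| + 1))).
  by rewrite ler_pM2l// lerDl.
rewrite -ltr_pdivlMr//; near: t; apply: nbhs_right_lt.
by rewrite divr_gt0.
Unshelve. all: by end_near. Qed.

Lemma boundaryP x : boundary Omega x <-> closure Omega x /\ ~ Omega x.
Proof. by rewrite /boundary (interior_id _).1. Qed.

Lemma defining_function_boundary y U rho x : local_defining_function Omega y U rho ->
  boundary Omega x -> U x -> rho x = 0.
Proof.
move=> [oU _ Crho _ rhoP] /boundaryP[cx Ox] Ux.
apply/eqP; rewrite eq_le [X in _ && X]leNgt; apply/andP; split; last first.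
  by apply/negP => /(rhoP _ Ux).
rewrite leNgt; apply/negP => r0.
have [/(_ x Ux) /cvgr_gt/(_ _ r0) rpos _] := Crho 0%N.
have nU : nbhs x U by exact: open_nbhs_nbhs.
have [w [Ow [/= rw Uw]]] := cx _ (filterI rpos nU).
by have := (rhoP _ Uw).1 Ow; rewrite ltNge (ltW rw).
Qed.

Lemma defining_function_descent y U rho x v : local_defining_function Omega y U rho ->
  boundary Omega x -> U x -> dot (gradient rho x) v < 0 ->
  \forall t \near (0 : R)^'+, Omega (x + t *: v).
Proof.
move=> D bx Ux g0; have rx := defining_function_boundary D bx Ux.
have [oU _ Crho _ rhoP] := D.
have := cvg_quotient_right (is_derive_C1 v oU (Crho 1%N) Ux).
move=> /cvgr_lt/(_ _ g0) neg.
have nU : \forall t \near (0 : R)^'+, U (x + t *: v).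
  by apply: near_line_right; exact: open_nbhs_nbhs.
near=> t; have t0 : 0 < t by near: t; exact: nbhs_right_gt.
apply/rhoP; first by near: t.
have : t^-1 * (rho (x + t *: v) - rho x) < 0 by near: t.
by rewrite rx subr0 pmulr_rlt0 ?invr_gt0.
Unshelve. all: by end_near. Qed.

(* Both gradients are outward normals, so the two half-spaces of inward
   directions agree and the gradients are positively proportional. *)
Lemma enorm_le_dot_normal y U rho U' rho' x :
  local_defining_function Omega y U rho ->
  local_defining_function Omega x U' rho' ->
  boundary Omega x -> U x ->
  enorm (gradient rho x) <=
    dot (gradient rho x) ((enorm (gradient rho' x))^-1 *: gradient rho' x).
Proof.
move=> D D' bx Ux; have rx := defining_function_boundary D bx Ux.
have [oU _ Crho _ rhoP] := D.
have [_ U'x _ /(_ _ U'x) a0 _] := D'.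
set b := gradient rho x; set a := gradient rho' x in a0 *.
have key v : dot a v < 0 -> dot b v <= 0.
  move=> av; rewrite leNgt; apply/negP => bv.
  have := cvg_quotient_right (is_derive_C1 v oU (Crho 1%N) Ux).
  move=> /cvgr_gt/(_ _ bv) pos.
  have desc := defining_function_descent D' bx U'x av.
  have nU : \forall t \near (0 : R)^'+, U (x + t *: v).
    by apply: near_line_right; exact: open_nbhs_nbhs.
  have /filter_ex[t [t0 pt Ot Ut]] : \forall t \near (0 : R)^'+,
    [/\ 0 < t, 0 < t^-1 * (rho (x + t *: v) - rho x), Omega (x + t *: v)
      & U (x + t *: v)].
    by near=> t; split; near: t => //; exact: nbhs_right_gt.
  move: pt; rewrite rx subr0 pmulr_rgt0 ?invr_gt0// ltNge => /negP; apply.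
  by apply: ltW; apply/rhoP.
have aa0 : 0 < dot a a by exact: dot_gt0.
have ab0 : 0 <= dot b a.
  have := key (- a); rewrite !dotNr oppr_lt0 oppr_le0; exact.
(* The reverse Cauchy-Schwarz inequality. If it failed, the component of [b] orthogonal to [a],
   tilted by [- e *: a] to point strictly inward for [a], would still have a positive product with
   [b]. *)
have ab : dot a a * dot b b <= dot b a ^+ 2.
  rewrite leNgt; apply/negP => lt.
  pose d := dot a a * dot b b - dot b a ^+ 2.
  have d0 : 0 < d by rewrite subr_gt0.
  pose e := d / (2 * (dot b a + 1)).
  have e0 : 0 < e by rewrite divr_gt0// mulr_gt0// ltr_wpDl.
  have := key (dot a a *: b - dot b a *: a - e *: a).
  rewrite !dotDr !dotNr !dotZr (dotC a b) => /(_ _)/wrap[].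
    have : 0 < e * dot a a by rewrite mulr_gt0.
    by move: (dot a a) (dot b a) => p q; nra.
  rewrite leNgt => /negP; apply.
  have : e * dot b a < d.
    rewrite /e mulrAC ltr_pdivrMr ?ltr_pM2l// ?mulr_gt0 ?ltr_wpDl//; lra.
  by rewrite /d; lra.
rewrite dotZr ler_pdivlMl ?sqrtr_gt0//.
rewrite /enorm -sqrtrM ?(ltW aa0)// -[leRHS]ger0_norm// -sqrtr_sqr.
by rewrite ler_wsqrtr.
Unshelve. all: by end_near. Qed.

End defining_functions.

Lemma continuous_at_sum (R : realType) (T : topologicalType) (n : nat)
    (h : 'I_n -> T -> R) (x : T) : (forall i, {for x, continuous (h i)}) ->
  {for x, continuous (fun y => \sum_(i < n) h i y)}.
Proof.
move=> ch; apply: (@cvg_big _ _ +%R 0 xpredT _ _ (nbhs x) _ h (h^~ x)).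
  exact: add_continuous.
by move=> i _; exact: ch.
Qed.

(** * Barriers built from a defining function *)

Section hopf.
Variables (R : realType) (n : nat) (Omega : set 'rV[R]_n) (f : 'rV[R]_n -> R).
Hypothesis oO : open Omega.
Hypothesis f_ge0 : forall x, Omega x -> 0 <= f x.
Hypothesis lift : forall x, Omega x -> locally_lifted Omega f x.
Implicit Types (u rho : 'rV[R]_n -> R) (x y z : 'rV[R]_n) (m c : R).

(** [P] marks the points handled by other means, such as those near the boundary, where a uniform
    gain cannot be expected. Letting [c] tend to 0 from the right in the near-covering property
    amounts to taking the least of finitely many local constants. *)
Lemma compact_lift (K : set 'rV[R]_n) (P : 'rV[R]_n -> Prop) : compact K ->
  (forall y, K y -> Omega y \/ \forall y' \near y, P y') ->
  exists2 c, 0 < c & forall y, K y -> P y \/ lifted Omega f c y.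
Proof.
move=> /compact_near_coveringP cK H.
have cover y : K y -> \forall y' \near y & c \near (0 : R)^'+,
    P y' \/ lifted Omega f c y'.
  move=> Ky; have [/lift[r [c [r0 c0 yc]]]|Py] := H y Ky.
    have yr : \forall y' \near y, `|y' - y| < r by apply/nbhs_normrP; exists r.
    near=> y' c'; right => /=; apply: (@le_lifted _ _ _ _ c).
      by apply: ltW => /=; near: c'; exact: nbhs_right_lt.
    by apply: yc => /=; near: y'.
  by near=> y' c'; left => /=; near: y'.
have cP := cK R (0 : R)^'+ (fun c y => P y \/ lifted Omega f c y) _ cover.
have /filter_ex[c [c0 cK']] : \forall c \near (0 : R)^'+,
    0 < c /\ K `<=` (fun y => P y \/ lifted Omega f c y).
  by near=> c; split; near: c; [exact: nbhs_right_gt | exact: cP].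
by exists c.
Unshelve. all: by end_near. Qed.

(* With [k] large the square makes this subharmonic near the boundary.  It is
   nonpositive on the boundary, where [rho = 0], while the squared distance makes
   it nonpositive away from [z] as long as [rho] is small. *)
Definition hopf_barrier rho (k : R) z y : R :=
  k * (rho y * rho y) - (rho y + dot (y - z) (y - z)).

Lemma has_laplacian_hopf_barrier (U : set 'rV[R]_n) rho (k : R) z x :
  open U -> Ck_on U 2 rho -> U x ->
  has_laplacian (hopf_barrier rho k z) x
    (k * (2 * (rho x * laplacian rho x) + 2 * dot (gradient rho x) (gradient rho x))
     - (laplacian rho x + 2 * n%:R)).
Proof.
move=> oU Crho Ux.
have j i := jet2B (jet2Z k (jet2M (jet2_Ck i oU Crho Ux) (jet2_Ck i oU Crho Ux)))
  (jet2D (jet2_Ck i oU Crho Ux) (jet2_sqdist i z x)).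
exists (fun i => k * (rho x * partial i rho x + rho x * partial i rho x) -
    (partial i rho x + 2 * (x - z) 0 i)).
exists (fun i => k * (rho x * partial i (partial i rho) x +
     2 * (partial i rho x * partial i rho x) +
     rho x * partial i (partial i rho) x) - (partial i (partial i rho) x + 2)).
split; first exact: j.
rewrite big_split/= sumrN -mulr_sumr !big_split/= -!mulr_sumr.
rewrite !sumr_const !card_ord.
rewrite -[\sum_(i < n) partial i (partial i rho) x]/(laplacian rho x).
have -> : dot (gradient rho x) (gradient rho x) =
    \sum_(i < n) partial i rho x * partial i rho x.
  by apply: eq_bigr => i _; rewrite mxE.
ring.
Qed.

Lemma continuous_hopf_barrier rho (k : R) z x :
  {for x, continuous rho} -> {for x, continuous (hopf_barrier rho k z)}.
Proof.
move=> cr; apply: (@continuousB _ _ _ (fun y => k * (rho y * rho y))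
  (fun y => rho y + dot (y - z) (y - z))).
  apply: (@continuousM _ _ (cst k) (fun y => rho y * rho y)).
    exact: cst_continuous.
  exact: (@continuousM _ _ rho rho).
apply: (@continuousD _ _ _ rho (fun y => dot (y - z) (y - z))) => //.
exact: continuous_sqdist.
Qed.

(** Comparison on the part of a closed ball around [z] lying in the closure of [Omega]. The barrier
    is nonpositive on the boundary of [Omega] and on the rim of the ball close to it; on the rest of
    the rim [compact_lift] supplies a gain; inside, the barrier is subharmonic. The constants
    precede [z], which gives uniformity near [y]. *)
Lemma hopf_lower_bound y U rho : local_defining_function Omega y U rho ->
  boundary Omega y ->
  exists r k e g, [/\ 0 < r, 0 < e, 0 < g &
    forall z, `|z - y| < r -> boundary Omega z ->
    [/\ U z, g <= enorm (gradient rho z) &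
     forall u m, supersolution Omega f u m ->
       {within closure Omega, continuous u} ->
       (forall x, closure Omega x -> m <= u x) ->
       forall x, closure Omega x -> `|x - z| <= r ->
       m + e * hopf_barrier rho k z x <= u x]].
Proof.
move=> D bdy; have [oU Uy Crho nz rhoP] := D.
have ry := defining_function_boundary oO D bdy Uy.
have C2 := Crho 2%N; have [C0 C1] := C2.
have cgrad : {for y, continuous (fun x => dot (gradient rho x) (gradient rho x))}.
  have -> : (fun x => dot (gradient rho x) (gradient rho x)) =
      (fun x => \sum_(i < n) partial i rho x * partial i rho x).
    by apply/funext => x; apply: eq_bigr => i _; rewrite mxE.
  apply: continuous_at_sum => i.
  have [_ [/(_ y Uy) ci _]] := C1 i.
  exact: (@continuousM _ _ (partial i rho) (partial i rho)).
have clap : {for y, continuous (laplacian rho)}.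
  apply: continuous_at_sum => i.
  by have [_ [_ /(_ i)[_ [/(_ y Uy)]]]] := C1 i.
set G := dot (gradient rho y) (gradient rho y).
have G0 : 0 < G by apply: dot_gt0; exact: nz.
pose g := G / 2; have g0 : 0 < g by rewrite divr_gt0.
pose d : R := `|laplacian rho y| + 1; have d0 : 0 < d by rewrite ltr_wpDl.
pose eta : R := g / (2 * d); have eta0 : 0 < eta by rewrite divr_gt0// mulr_gt0.
(* Since [2 * eta * d = g], the bounds on [rho], its gradient and its Laplacian make the Laplacian
   of the barrier exceed [k * g - d - 2 * n], which is 1. *)
pose k : R := (d + 2 * n%:R + 1) / g.
have k0 : 0 < k by rewrite divr_gt0// ltr_wpDl// addr_ge0 ?mulr_ge0// ltW.
have : \forall x \near y, [/\ U x, g < dot (gradient rho x) (gradient rho x),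
    `|laplacian rho x| < d & `|rho x| < eta].
  have n1 : nbhs y U by exact: open_nbhs_nbhs.
  have n2 : \forall x \near y, g < dot (gradient rho x) (gradient rho x).
    by move: cgrad => /cvgr_gt; apply; rewrite /g -/G; lra.
  have n3 : \forall x \near y, `|laplacian rho x| < d.
    by move: clap => /cvg_norm/cvgr_lt; apply; rewrite /d; lra.
  have n4 : \forall x \near y, `|rho x| < eta.
    by move: (C0 y Uy) => /cvg_norm/cvgr_lt; apply; rewrite ry normr0.
  by near=> x; split; near: x.
move=> /nbhs_normrP[r0 r00 r0P].
pose r := r0 / 3; have rr0 : 0 < r by rewrite divr_gt0.
have near3 z x : `|z - y| < r -> `|x - z| <= r -> `|x - y| <= 2 * r.
  move=> zy xz; rewrite -(subrK z x) -addrA (le_trans (ler_normD _ _))//; lra.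
have lt3 x : `|x - y| <= 2 * r -> `|x - y| < r0.
  by move=> /le_lt_trans; apply; rewrite /r; lra.
(* On the rim, [- s < rho < 0] bounds the barrier by [(1 + k) * s - r ^+ 2]; the cap at 1 gives
   [rho * rho <= s]. *)
pose s := Num.min 1 (r ^+ 2 / (1 + k)).
have s0 : 0 < s by rewrite lt_min ltr01 divr_gt0 ?exprn_gt0 ?addr_gt0.
have [|c c0 cP] := @compact_lift [set x | `|x - y| <= 2 * r]
  (fun x => - s < rho x) (@compact_closed_ball R n y (2 * r)) _.
  move=> x /lt3/r0P[Ux _ _ _]; have [rx|rx] := ltP (rho x) 0.
    by left; apply/rhoP.
  by right; move: (C0 x Ux) => /cvgr_gt; apply; rewrite (lt_le_trans _ rx)// oppr_lt0.
(* The denominator bounds the barrier wherever [rho] is at most [eta] in absolute value, so the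
   scaled barrier is at most the gain [c]. *)
pose e := c / (eta + k * eta ^+ 2).
have E0 : 0 < eta + k * eta ^+ 2 by rewrite addr_gt0// mulr_gt0// exprn_gt0.
have e0 : 0 < e by rewrite divr_gt0.
exists r, k, e, (Num.sqrt g); split => //; first by rewrite sqrtr_gt0.
move=> z zy bz.
have zyr : `|z - y| < r0 by apply: lt3; lra.
have [Uz gz _ _] := r0P z zyr.
split => //; first by rewrite ler_wsqrtr// ltW.
move=> u m S cu um x cx xz.
pose K := [set x | `|x - z| <= r] `&` closure Omega.
have cK : compact K.
  by apply: compact_closedI; [exact: compact_closed_ball | exact: closed_closure].
apply: (@comparison_principle _ _ K u (fun x => e * hopf_barrier rho k z x)) => //.
- by apply: continuous_subspaceW cu => w [].
- apply: continuous_in_subspaceT => w; rewrite inE => -[/= wz cw].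
  have [Uw _ _ _] := r0P w (lt3 _ (near3 _ _ zy wz)).
  apply: (@continuousM _ _ (cst e) (hopf_barrier rho k z)).
    exact: cst_continuous.
  by apply: continuous_hopf_barrier; exact: C0.
move=> w [/= wz cw].
have wy := near3 _ _ zy wz.
have [Uw gw lw rw] := r0P w (lt3 _ wy).
have dw : 0 <= dot (w - z) (w - z) by exact: dot_ge0.
have nonpos : hopf_barrier rho k z w <= 0 -> m + e * hopf_barrier rho k z w <= u w.
  by move=> b0; apply: le_trans (um _ cw); rewrite gerDl mulr_ge0_le0// ltW.
have [Ow|Ow] := pselect (Omega w); last first.
  left; apply: nonpos.
  have /boundaryP bw : closure Omega w /\ ~ Omega w by [].
  rewrite /hopf_barrier (defining_function_boundary oO D (bw oO) Uw).
  by rewrite !mulr0 sub0r add0r oppr_le0.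
have rw0 := (rhoP _ Uw).1 Ow.
have [wzr|wzr] := ltP `|w - z| r; last first.
  have [sw|lc] := cP w wy; last first.
    left; apply: le_trans (lc _ _ S); rewrite lerD2l.
    rewrite -[c](divfK (lt0r_neq0 E0)) -/e ler_pM2l// /hopf_barrier.
    move: rw; rewrite ltr_norml => /andP[rw _].
    have : rho w * rho w <= eta ^+ 2 by nra.
    move=> /(ler_wpM2l (ltW k0)); lra.
  left; apply: nonpos; rewrite /hopf_barrier.
  have rd : r ^+ 2 <= dot (w - z) (w - z).
    apply: le_trans (norm_sqr_le_dot _).
    by rewrite lerXn2r ?nnegrE// ltW.
  have /andP[s1 sr] : (s <= 1) && (s <= r ^+ 2 / (1 + k)).
    by rewrite !ge_min !lexx orbT.
  rewrite ler_pdivlMr ?addr_gt0// in sr.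
  have : rho w * rho w <= s by nra.
  move=> /(ler_wpM2l (ltW k0)); nra.
right; split.
  have nO : nbhs w Omega by exact: open_nbhs_nbhs.
  have nz' : \forall w' \near w, `|w' - z| < r.
    apply/nbhs_normrP; exists (r - `|w - z|); first by rewrite subr_gt0.
    move=> w' w'w; rewrite -(subrK w w') -addrA (le_lt_trans (ler_normD _ _))//.
    by rewrite -ltrBrDr.
  near=> w'; split; first by rewrite /= ltW//; near: w'.
  by apply: subset_closure; near: w'.
exists (laplacian u w); eexists; split.
- by case: S => Cu _ _; exact: has_laplacian_Ck Cu Ow.
- exact: has_laplacianZ (has_laplacian_hopf_barrier k z oU C2 Uw).
case: S => _ /(_ _ Ow) Lu _; apply: (@lt_trans _ _ 0).
  by rewrite (lt_le_trans Lu)// oppr_le0 f_ge0.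
rewrite mulr_gt0//.
have kg : k * g = d + 2 * n%:R + 1 by rewrite /k divfK// gt_eqF.
have ed : 2 * (eta * d) = g.
  by rewrite /eta mulrCA -mulrA mulVf ?mulr1// gt_eqF// mulr_gt0.
have rl : - (eta * d) <= rho w * laplacian rho w.
  rewrite lerNl (le_trans (ler_norm _))// normrN normrM.
  by rewrite ler_pM// ltW.
have := ler_wpM2l (ltW k0) rl.
have := ltr_pM2l k0 g (dot (gradient rho w) (gradient rho w)).
rewrite gw => k2.
move: lw; rewrite ltr_norml => /andP[_ lw] k1.
have : k * (2 * (eta * d)) = k * g by rewrite ed.
lra.
Unshelve. all: by end_near. Qed.

End hopf.

(** * Normal derivatives at boundary minima *)

Lemma near_right0P (R : realType) (P : R -> Prop) :
  (\forall t \near (0 : R)^'+, P t) ->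
  exists2 d : R, 0 < d & forall t, 0 < t < d -> P t.
Proof.
move=> /nbhs_ballP[d /= d0 dP]; exists d => // t /andP[t0 td].
by apply: dP => //; rewrite /ball/= sub0r normrN gtr0_norm.
Qed.

Lemma Ck_on21 (R : realType) (n : nat) (U : set 'rV[R]_n) (g : 'rV[R]_n -> R) :
  Ck_on U 2 g -> Ck_on U 1 g.
Proof. by move=> [cg C]; split => // i; have [dg [cdg _]] := C i. Qed.

Lemma cvg_line_within (R : realType) (n : nat) (T : topologicalType)
    (A : set 'rV[R]_n) (g : 'rV[R]_n -> T) (x v : 'rV[R]_n) :
  {within A, continuous g} -> A x -> (\forall t \near (0 : R)^'+, A (x + t *: v)) ->
  (fun t : R => g (x + t *: v)) @ 0^'+ --> g x.
Proof.
move=> /subspace_continuousP cg Ax At B /(cg x Ax) nB.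
have := near_line_right v nB; rewrite /= => nBt.
by apply: filterS2 At nBt => t Axt; exact.
Qed.

Lemma compact_closure_bounded (R : realType) (n : nat) (A : set 'rV[R]_n) :
  bounded_set A -> compact (closure A).
Proof.
move=> [M [Mr MA]].
apply: subclosed_compact (@compact_closed_ball R n 0 (M + 1)) _ => //.
  exact: closed_closure.
have cB : closed [set y : 'rV[R]_n | `|y - 0| <= M + 1].
  exact: compact_closed (@norm_hausdorff _ _) (@compact_closed_ball R n 0 (M + 1)).
rewrite ((closure_id _).1 cB); apply: closureS => y Ay /=.
by rewrite subr0; apply: (MA (M + 1)) => //; rewrite ltrDl.
Qed.

Section hopf_lemma.
Variables (R : realType) (n : nat) (Omega : set 'rV[R]_n) (f : 'rV[R]_n -> R).
Variable nu : 'rV[R]_n -> 'rV[R]_n.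
Hypothesis oO : open Omega.
Hypothesis f_ge0 : forall x, Omega x -> 0 <= f x.
Hypothesis lift : forall x, Omega x -> locally_lifted Omega f x.
Hypothesis hnu : outward_unit_normal Omega nu.

Definition hopf_bound (kappa : R) (z : 'rV[R]_n) : Prop :=
  forall u m G, supersolution Omega f u m ->
    {within closure Omega, continuous u} ->
    (forall x, closure Omega x -> m <= u x) -> u z = m ->
    gradient_extension Omega u G -> dot (G z) (nu z) <= - kappa.

(** At [z] the quadratic terms of the barrier have zero derivative, so its inward slope is the
    product of [gradient rho z] with [nu z], at least [g]. As [u] touches the scaled barrier plus
    [m] from above at [z], a smaller inward slope of [u] would take it below the barrier on a short
    segment. *)
Lemma hopf_lemma y U rho : local_defining_function Omega y U rho ->
  boundary Omega y ->
  exists r kappa, [/\ 0 < r, 0 < kappa &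
    forall z, `|z - y| < r -> boundary Omega z -> hopf_bound kappa z].
Proof.
move=> D bdy.
have [r [k [e [g [r0 e0 g0 H]]]]] := hopf_lower_bound oO f_ge0 lift D bdy.
exists r, (e * g); split => //; first exact: mulr_gt0.
move=> z zy bz u m G S cu um uz [cG GO].
have [Uz gz lower] := H z zy bz.
have [U' [rho' [D' nuE]]] := hnu bz.
have [oU _ Crho _ _] := D.
have [_ U'z _ /(_ _ U'z) nz' _] := D'.
have rz := defining_function_boundary oO D bz Uz.
have en0 : 0 < enorm (gradient rho' z) by rewrite sqrtr_gt0 dot_gt0.
set v := - nu z; set db := dot (gradient rho z) (nu z).
have dbg : g <= db.
  by apply: (le_trans gz); rewrite /db nuE; exact: enorm_le_dot_normal D D' bz Uz.
rewrite lerNr -dotNr -/v; apply: (@le_trans _ _ (e * db)); first by rewrite ler_pM2l.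
rewrite leNgt; apply/negP => lt.
(* A slope strictly between the two: continuity of [G] keeps the derivative of [u] below [mu] along
   the segment, while the barrier's difference quotients, scaled by [e], exceed it. *)
pose mu := (dot (G z) v + e * db) / 2.
have mu1 : dot (G z) v < mu by rewrite /mu; lra.
have mu2 : mu / e < db by rewrite ltr_pdivrMr// mulrC /mu; lra.
have dhb : is_derive z v (hopf_barrier rho k z) db.
  have dr := is_derive_C1 v oU (Crho 1%N) Uz.
  have dq := is_derive_sqdist z z v.
  have := is_derive_subf (is_derive_mulf (is_derive_cst k z v) (is_derive_mulf dr dr))
    (is_derive_addf dr dq).
  congr is_derive; rewrite rz subrr dot0l /cst /v dotNr -/db; ring.
have hb0 : hopf_barrier rho k z z = 0.
  by rewrite /hopf_barrier rz subrr dot0l; ring.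
have n1 : \forall t \near (0 : R)^'+, Omega (z + t *: v).
  apply: (defining_function_descent oO D' bz U'z).
  rewrite /v dotNr nuE dotZr oppr_lt0 mulr_gt0 ?invr_gt0//; exact: dot_gt0.
have n2 : \forall t \near (0 : R)^'+, closure Omega (z + t *: v).
  by apply: filterS n1 => t; exact: subset_closure.
have cz : closure Omega z by case: bz.
have n3 : \forall t \near (0 : R)^'+, dot (G (z + t *: v)) v < mu.
  have cGv : (fun t : R => dot (G (z + t *: v)) v) @ 0^'+ --> (dot (G z) v : R).
    by apply: cvg_dot; [exact: cvg_line_within cG cz n2 | exact: cvg_cst].
  by move: cGv => /cvgr_lt; apply.
have n4 : \forall t \near (0 : R)^'+, mu / e < t^-1 * hopf_barrier rho k z (z + t *: v).
  have := cvg_quotient_right dhb; rewrite hb0 => /cvgr_gt/(_ _ mu2).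
  by apply: filterS => t; rewrite subr0.
have n5 : \forall t \near (0 : R)^'+, `|z + t *: v - z| < r.
  by apply: (@near_line_right _ _ (fun w => `|w - z| < r)); apply/nbhs_normrP; exists r.
have /near_right0P[d d0 dP] : \forall t \near (0 : R)^'+,
    [/\ Omega (z + t *: v), dot (G (z + t *: v)) v < mu,
        mu / e < t^-1 * hopf_barrier rho k z (z + t *: v) & `|z + t *: v - z| < r].
  by near=> t; split; near: t.
pose t := d / 2; have t0 : 0 < t by rewrite divr_gt0.
have td : t < d by rewrite /t; lra.
have der s : 0 < s < d ->
    is_derive s (1 : R) (fun s => u (z + s *: v)) (dot (G (z + s *: v)) v).
  move=> /dP[Os _ _ _]; apply: is_derive_line; rewrite GO//.
  by case: S => /Ck_on21 Cu _ _; exact: is_derive_C1 Cu Os.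
have cont (s : R) : 0 < s < d -> {for s, continuous (fun s : R => u (z + s *: v))}.
  by move=> /der[/derivable1_diffP/differentiable_continuous].
have [|||c] := @MVT R (fun s => u (z + s *: v)) (fun s => dot (G (z + s *: v)) v) 0 t.
- exact: t0.
- move=> s; rewrite in_itv/= => /andP[s0 st]; apply: der.
  by rewrite s0 (lt_trans st).
- apply/continuous_within_itvP => //; split.
  + move=> s; rewrite in_itv/= => /andP[s0 st]; apply: cont.
    by rewrite s0 (lt_trans st).
  + by rewrite scale0r addr0; exact: cvg_line_within cu cz n2.
  + by apply: cvg_at_left_filter; apply: cont; rewrite t0.
rewrite in_itv/= => /andP[c0 ct].
rewrite scale0r addr0 subr0 uz => E.
have [_ Gc _ _] : [/\ Omega (z + c *: v), dot (G (z + c *: v)) v < mu,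
        mu / e < c^-1 * hopf_barrier rho k z (z + c *: v) & `|z + c *: v - z| < r].
  by apply: dP; rewrite c0 (lt_trans ct).
have [|Ot _ qt rt] := dP t; first by rewrite t0.
have := lower u m S cu um _ (subset_closure Ot) (ltW rt).
rewrite -lerBrDl E leNgt => /negP; apply.
apply: (@lt_trans _ _ (mu * t)); first by rewrite ltr_pM2r.
by move: qt; rewrite ltr_pdivrMr// -mulrA ltr_pdivlMl// mulrC (mulrC e).
Unshelve. all: by end_near. Qed.

(** A Hopf bound persists when [kappa] decreases, so the local constants combine by compactness of
    the boundary. *)
Lemma hopf_uniform : bounded_set Omega -> smooth_boundary Omega ->
  exists2 kappa, 0 < kappa & forall z, boundary Omega z -> hopf_bound kappa z.
Proof.
move=> bO sO.
have cb : near_covering (boundary Omega).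
  apply/compact_near_coveringP.
  apply: compact_closedI (compact_closure_bounded bO) _.
  by apply: open_closedC; exact: open_interior.
have cover y : boundary Omega y -> \forall y' \near y & c \near (0 : R)^'+,
    boundary Omega y' -> hopf_bound c y'.
  move=> bdy; have [U [rho D]] := sO y bdy.
  have [r [k [r0 k0 H]]] := hopf_lemma D bdy.
  have yr : \forall y' \near y, `|y' - y| < r by apply/nbhs_normrP; exists r.
  near=> y' c' => /= bdw; have H' : hopf_bound k y' by apply: H bdw; near: y'.
  move=> u m G S cu um uz GE; apply: le_trans (H' u m G S cu um uz GE) _.
  by rewrite lerN2 ltW//; near: c'; exact: nbhs_right_lt.
have cP := cb R (0 : R)^'+ (fun c y => boundary Omega y -> hopf_bound c y) _ cover.
have /filter_ex[c [c0 cK']] : \forall c \near (0 : R)^'+,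
    0 < c /\ boundary Omega `<=` (fun y => boundary Omega y -> hopf_bound c y).
  by near=> c; split; near: c; [exact: nbhs_right_gt | exact: cP].
by exists c => // z bz; exact: cK'.
Unshelve. all: by end_near. Qed.

End hopf_lemma.

(** * Nonexistence *)

(** Let [t] be the maximum of the ratio [b / u] on the ball, attained at [x1]. Then [t * u - b] has
    a local minimum at [x1], so the Laplacian of [b] there is at most [- L * b]. For the cubic
    barrier this is a quadratic inequality in [q] that fails for large [L]. *)
Lemma large_supersolution_bound (R : realType) (n : nat) (Omega : set 'rV[R]_n)
    (z : 'rV[R]_n) (r L : R) (u : 'rV[R]_n -> R) :
  open Omega -> 0 < r -> (forall x, `|x - z| <= r -> Omega x) ->
  Ck_on Omega 2 u -> (forall x, Omega x -> 0 < u x) ->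
  (forall x, Omega x -> laplacian u x <= - L * u x) ->
  L < (6 * n%:R + 24) ^+ 2 / r ^+ 2.
Proof.
move=> oO r0 BO Cu u0 Lu; rewrite ltNge; apply/negP => Lbig.
have r20 : 0 < r ^+ 2 by rewrite exprn_gt0.
pose b := barrier z (r ^+ 2) 1.
pose K := [set x : 'rV[R]_n | `|x - z| <= r].
have cu x : K x -> {for x, continuous u}.
  by move=> /BO Ox; case: Cu => + _; exact.
have Kz : K z by rewrite /K/= subrr normr0 ltW.
have cbu : {within K, continuous (fun x => b x * (u x)^-1)}.
  apply: continuous_in_subspaceT => x; rewrite inE => Kx.
  apply: (@continuousM _ _ b (fun x => (u x)^-1)).
    exact: continuous_barrier.
  apply: (@continuousV _ _ u); last exact: cu.
  by rewrite gt_eqF// u0//; exact: BO.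
have [|x1 Kx1 x1max] := compact_EVT_max _ (@compact_closed_ball R n z r) cbu.
  by exists z.
have {}x1max x : K x -> b x * (u x)^-1 <= b x1 * (u x1)^-1.
  by move=> Kx; apply: x1max; exact: mem_set.
have {}Kx1 : K x1 by rewrite inE in Kx1.
have Ox1 := BO _ Kx1; have ux1 := u0 _ Ox1.
set t := b x1 * (u x1)^-1 in x1max.
have t0 : 0 < t.
  apply: lt_le_trans (x1max z Kz); rewrite divr_gt0 ?(u0 _ (BO _ Kz))//.
  by rewrite /b/barrier subrr dot0l subr0 exprn_gt0.
have bx1 : b x1 = t * u x1 by rewrite /t divfK// gt_eqF.
have bpos : 0 < b x1 by rewrite bx1 mulr_gt0.
set s := dot (x1 - z) (x1 - z); set q := r ^+ 2 - s.
have q0 : 0 < q.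
by move: bpos; rewrite /b/barrier -/s -/q exprn_odd_gt0.
have x1r : `|x1 - z| < r.
  have : `|x1 - z| ^+ 2 < r ^+ 2.
    by apply: le_lt_trans (norm_sqr_le_dot _) _; rewrite -/s -subr_gt0.
  by rewrite ltr_pXn2r ?nnegrE// ltW.
have near_min : \forall x \near x1, t * u x1 - b x1 <= t * u x - b x.
  apply/nbhs_normrP; exists (r - `|x1 - z|); first by rewrite subr_gt0.
  move=> x xx1; have Kx : K x.
    rewrite /K/= -(subrK x1 x) -addrA (le_trans (ler_normD _ _))//.
    by rewrite -lerBrDr ltW.
  have := x1max x Kx; rewrite ler_pdivrMr; last by rewrite u0//; exact: BO.
  by rewrite bx1 subrr subr_ge0.
have := laplacian_le_at_min (has_laplacianZ t (has_laplacian_Ck oO Cu Ox1))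
  (has_laplacian_barrier z (r ^+ 2) 1 x1) near_min.
rewrite -/s -/q expr1 => lap.
have : t * laplacian u x1 <= - L * b x1.
  by rewrite bx1 [leRHS]mulrCA ler_pM2l// Lu.
move=> /(le_trans lap); rewrite /b/barrier -/s -/q.
have -> : 3 * q * (4 * 2 * s - 2 * n%:R * q) <= - L * q ^+ 3 =
   (L * q ^+ 2 <= (6 * n%:R + 24) * q - 24 * r ^+ 2) :> bool.
  have -> : - L * q ^+ 3 = q * (- L * q ^+ 2) by ring.
  rewrite (mulrC 3) -(mulrA q) ler_pM2l// -lerN2.
  congr (_ <= _); first ring.
  have -> : s = r ^+ 2 - q by rewrite /q; ring.
  ring.
rewrite leNgt => /negP; apply.
(* Completing the square: [w ^+ 2 * q ^+ 2 - w * r * q + 24 * r ^+ 2] is the square of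
   [w * q - r / 2] plus a positive multiple of [r ^+ 2]. *)
pose w := (6 * n%:R + 24) / r.
have wr : w ^+ 2 <= L by rewrite /w expr_div_n.
have -> : 6 * n%:R + 24 = w * r by rewrite /w divfK// gt_eqF.
have : w ^+ 2 * q ^+ 2 <= L * q ^+ 2 by rewrite ler_wpM2r// sqr_ge0.
have := sqr_ge0 (w * q - r / 2); nra.
Qed.

Theorem theorem1p1 (R : realType) (n : nat) (hn : (2 <= n)%N)
  (Omega : set 'rV[R]_n)
  (hdom : bounded_domain Omega)
  (hbd : smooth_boundary Omega)
  (nu : 'rV[R]_n -> 'rV[R]_n)
  (hnu : outward_unit_normal Omega nu)
  (f : 'rV[R]_n -> R)
  (hf : C1_closure Omega f)
  (hf_ge0 : forall x, closure Omega x -> 0 <= f x)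
  (hf_neq0 : exists2 x, closure Omega x & f x != 0)
  (p : R) (hp1 : 1 < p)
  (hp2 : (2 < n)%N -> p < (n%:R + 2) / (n%:R - 2)) :
  exists2 beta_f : R, 0 < beta_f &
    forall beta : R, 0 < beta < beta_f ->
      ~ exists u : 'rV[R]_n -> R, robin_solution Omega nu p f beta u.
Proof.
have [oO cO O0 bO] := hdom.
have f_ge0 x : Omega x -> 0 <= f x by move=> Ox; apply: hf_ge0; exact: subset_closure.
have [[Cf _] cf _] := hf.
(* The point where [f] is nonzero may lie on the boundary; continuity up to the closure moves it
   inside. *)
have [z Oz fz] : exists2 z, Omega z & 0 < f z.
  have [x cx fx] := hf_neq0.
  have fx0 : 0 < f x by rewrite lt_def fx hf_ge0.
  have /subspace_continuousP/(_ x cx)/cvgr_gt/(_ _ fx0) nf := cf.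
  have [z [Oz /= zf]] := cx _ nf.
  by exists z => //; apply: zf; exact: subset_closure.
have : \forall x \near z, Omega x /\ f z / 2 < f x.
  have n1 : nbhs z Omega by exact: open_nbhs_nbhs.
  have n2 : \forall x \near z, f z / 2 < f x.
    by move: (Cf z Oz) => /cvgr_gt; apply; lra.
  by near=> x; split; near: x.
move=> /nbhs_normrP[r1 r10 r1P].
pose r := r1 / 2; have r0 : 0 < r by rewrite divr_gt0.
have rP x : `|x - z| <= r -> Omega x /\ f z / 2 <= f x.
  move=> xz; have [] := r1P x; first by apply: le_lt_trans xz _; rewrite /r; lra.
  by move=> Ox /ltW.
have fz2 : 0 < f z / 2 by rewrite divr_gt0.
have lz := lifted_source hn oO r0 fz2 rP.
have lift := locally_lifted_connected hn oO f_ge0 cO Oz lz.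
have [kappa kappa0 hopf] := hopf_uniform oO f_ge0 lift hnu bO hbd.
pose L := (6 * n%:R + 24) ^+ 2 / r ^+ 2.
have L0 : 0 < L by rewrite divr_gt0 ?exprn_gt0// ltr_wpDl.
have p10 : 0 < p - 1 by rewrite subr_gt0.
pose m0 := L `^ (p - 1)^-1; have m00 : 0 < m0 by rewrite powR_gt0.
have m0L : m0 `^ (p - 1) = L.
  by rewrite /m0 -powRrM mulVf ?gt_eqF// powRr1// ltW.
(* The Hopf bound and the Robin condition give [kappa <= beta * u x0], so [beta < kappa / m0] forces
   [u x0 > m0], the level at which the power [p - 1] reaches the critical [L]. *)
exists (kappa / m0); first by rewrite divr_gt0.
move=> beta /andP[beta0 betak] [u [Cu [_ cu _] eqn u0 robin]].
have Lu x : Omega x -> laplacian u x = - (u x `^ p + f x).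
  by move=> Ox; rewrite -eqn// opprK.
have cl0 : closure Omega !=set0 by exists z; exact: subset_closure.
have [x0 cx0 x0min] := compact_EVT_min cl0 (compact_closure_bounded bO) cu.
have {}x0min x : closure Omega x -> u x0 <= u x.
  by move=> cx; apply: x0min; exact: mem_set.
have {}cx0 : closure Omega x0 by rewrite inE in cx0.
have ltLu x : Omega x -> laplacian u x < - f x.
  by move=> Ox; rewrite Lu// ltrN2 ltrDr powR_gt0// u0.
(* An interior minimum would make the Laplacian nonnegative, by comparison with the zero function,
   against [laplacian u < - f <= 0]. *)
have Ox0 : ~ Omega x0.
  move=> Ox0; suff : 0 <= laplacian u x0.
    by rewrite leNgt (lt_le_trans (ltLu _ Ox0))// oppr_le0 f_ge0.
  apply: (@laplacian_le_at_min _ _ u (fun=> 0) x0).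
  - exact: has_laplacian_Ck Cu Ox0.
  - exists (fun=> 0), (fun=> 0); split => [i|]; first exact: jet2_cst.
    by rewrite big1.
  near=> x; rewrite !subr0; apply: x0min; apply: subset_closure.
  by near: x; exact: open_nbhs_nbhs.
have bx0 : boundary Omega x0 by apply/(boundaryP oO).
have S : supersolution Omega f u (u x0).
  by split => // x Ox; apply: x0min; exact: subset_closure.
have [c [G GE cE] c0] := robin x0 bx0.
have Gk := hopf x0 bx0 u (u x0) G S cu x0min erefl GE.
have ux0 : m0 < u x0.
  have kb : kappa <= beta * u x0 by rewrite -cE in Gk; lra.
  rewrite -(ltr_pM2l beta0); apply: lt_le_trans kb.
  by rewrite -ltr_pdivlMr.
suff : L < L by rewrite ltxx.
apply: (@large_supersolution_bound R n Omega z r L u) => //.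
  by move=> x /rP[].
move=> x Ox; have ux := u0 x Ox.
rewrite Lu// mulNr lerN2 (@le_trans _ _ (u x `^ p))//; last by rewrite lerDl f_ge0.
rewrite -[leRHS](mulr_powRB1 (ltW ux)) ?(lt_trans _ hp1)// mulrC ler_pM2l//.
rewrite -m0L ge0_ler_powR ?nnegrE ?(ltW p10) ?(ltW m00) ?(ltW ux)//.
apply: le_trans (ltW ux0) _; apply: x0min; exact: subset_closure.
Unshelve. all: by end_near. Qed.
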